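(* Let $e\in\mathbb{N}$ and let $a,b\in\mathbb{N}$ be such that $a\le q-2$ and $0\le b-ea$. For all pairs of positive integers $(a',b')$ such that $a\le q-a'-3$ or $a=q-a'-1$, there exists a code $C\simeq C_e(a,b)$ such that $$C\subset C_e(a',b')^\perp .$$
   Context: $q$ is a prime power, $\mathbb{F}_q=\{\alpha_1,\dots,\alpha_q\}$ is the field with $q$ elements, $\mathbb{N}=\{0,1,2,\dots\}$, and $0^0:=1$. Duals are taken with respect to the standard (Euclidean) bilinear form. Two linear codes $C,C'\subset\mathbb{F}_q^n$ are equivalent, written $C\simeq C'$, if there is $x=(x_1,\dots,x_n)\in(\mathbb{F}_q^* )^n$ such that $C'=\{(x_1c_1,\dots,x_nc_n)\mid (c_1,\dots,c_n)\in C\}$. For $a,b\in\mathbb{N}$, let $L_*(aS_e+bF_e)$ be the $\mathbb{F}_q$-span of the monomials $X_1^{d_1}X_2^{d_2}T_1^{c_1}T_2^{c_2}$ with nonnegative exponents satisfying $d_1+d_2=a$ and $c_1+c_2-ed_1=b-ea$. The code $C_e(a,b)\subset\mathbb{F}_q^{(q+1)^2}$ is the set of vectors $\big(f(x_1,x_2,t_1,t_2)\big)$, $f\in L_*(aS_e+bF_e)$, where $(x_1,x_2)$ and $(t_1,t_2)$ run independently over $(0,1),(1,\alpha_1),\dots,(1,\alpha_q)$ (with one fixed ordering of the coordinates for all codes). (This is the evaluation code on the $\mathbb{F}_q$-points of the Hirzebruch surface $\mathcal{H}_e$ attached to the divisor $aS_e+bF_e$.) *)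

(* Defs.v *)
From HB Require Import structures.
From mathcomp Require Import all_boot all_order all_algebra.
From mathcomp Require Import mpoly zify.

Set Implicit Arguments.
Unset Strict Implicit.
Unset Printing Implicit Defensive.

Import GRing.Theory.
Local Open Scope ring_scope.

Section LinearCodes.
Variables (F : finFieldType) (n : nat).
Implicit Types C D : {vspace 'rV[F]_n}.

Definition code_equiv C C' : Prop :=
  exists x : 'rV[F]_n, (forall i, x 0 i != 0) /\
    forall v, v \in C' <->
      exists2 c, c \in C & v = \row_(i < n) (x 0 i * c 0 i).

Definition dual_code D : {pred 'rV[F]_n} :=
  [pred v : 'rV[F]_n | [forall c : 'rV[F]_n in D, \sum_(i < n) v 0 i * c 0 i == 0]].

End LinearCodes.

(* The variables of {mpoly F[4]} are, in this order, X1, X2, T1, T2. *)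
Definition iX1 : 'I_4 := @Ordinal 4 0 isT.
Definition iX2 : 'I_4 := @Ordinal 4 1 isT.
Definition iT1 : 'I_4 := @Ordinal 4 2 isT.
Definition iT2 : 'I_4 := @Ordinal 4 3 isT.

(* Both equations are between integers: b - e a may be negative. *)
Definition L_monomial (e a b : nat) (m : 'X_{1..4}) : bool :=
  (m iX1 + m iX2 == a)%N &&
  ((m iT1)%:Z + (m iT2)%:Z - e%:Z * (m iX1)%:Z == b%:Z - e%:Z * a%:Z).

Definition L_space (F : finFieldType) (e a b : nat) (f : {mpoly F[4]}) : Prop :=
  exists (s : seq 'X_{1..4}) (k : 'X_{1..4} -> F),
    all (L_monomial e a b) s /\ f = \sum_(m <- s) k m *: 'X_[m].

Definition P1_points (F : finFieldType) : {set F * F} :=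
  (0, 1) |: [set (1, alpha) | alpha : F].

(* An ordering of the pairs ((x1, x2), (t1, t2)), that is, of the coordinates
   of the evaluation vectors. *)
Definition point_ordering (F : finFieldType) (n : nat)
    (pts : n.-tuple ((F * F) * (F * F))) : Prop :=
  uniq pts /\ pts =i setX (P1_points F) (P1_points F).

Definition point_val (F : finFieldType) (p : (F * F) * (F * F)) : 'I_4 -> F :=
  tnth [tuple p.1.1; p.1.2; p.2.1; p.2.2].

Definition eval_vector (F : finFieldType) (n : nat)
    (pts : n.-tuple ((F * F) * (F * F))) (f : {mpoly F[4]}) : 'rV[F]_n :=
  \row_(i < n) f.@[point_val (tnth pts i)].

(* The degree bound only makes the list of generators finite: every monomial
   in L_monomial e a b has total degree at most a + b. Lemma hirz_codeP below
   identifies this subspace with the set of all eval_vector pts f, f in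
   L_space e a b. *)
Definition hirz_code (F : finFieldType) (n : nat)
    (pts : n.-tuple ((F * F) * (F * F))) (e a b : nat) : {vspace 'rV[F]_n} :=
  <<[seq eval_vector pts 'X_[bmnm m]
      | m : 'X_{1..4 < (a + b).+1} in [pred m | L_monomial e a b (bmnm m)]]>>%VS.

Lemma L_monomial_mdeg e a b m : L_monomial e a b m -> (mdeg m < (a + b).+1)%N.
Proof.
move=> /andP[/eqP h1 /eqP h2].
have -> : mdeg m = (m iX1 + m iX2 + m iT1 + m iT2)%N.
  rewrite mdegE !big_ord_recr big_ord0 /= add0n.
  by congr (m _ + m _ + m _ + m _)%N; apply: val_inj.
move: (m iX1) (m iX2) (m iT1) (m iT2) h1 h2 => d1 d2 c1 c2 h1 h2.
nia.
Qed.

Lemma eval_vector_sum (F : finFieldType) n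
    (pts : n.-tuple ((F * F) * (F * F))) (I : Type) (s : seq I)
    (k : I -> F) (g : I -> {mpoly F[4]}) :
  eval_vector pts (\sum_(i <- s) k i *: g i) =
  \sum_(i <- s) k i *: eval_vector pts (g i).
Proof.
apply/rowP => j; rewrite mxE summxE raddf_sum /=.
by apply: eq_bigr => i _; rewrite mevalZ !mxE.
Qed.

Lemma L_spaceP (F : finFieldType) e a b (f : {mpoly F[4]}) :
  L_space e a b f <-> {subset msupp f <= L_monomial e a b}.
Proof.
split=> [[s [k [/allP Ls ->]]] m /msupp_sum_le | Lf].
  by case/flattenP=> _ /mapP[m' + ->] /msuppZ_le;
     rewrite filter_predT msuppX inE => /Ls ? /eqP->.
exists (msupp f), (fun m => f@_m); split; last exact: mpolyE.
by apply/allP => m /Lf.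
Qed.

Lemma hirz_codeP (F : finFieldType) n
    (pts : n.-tuple ((F * F) * (F * F))) e a b (v : 'rV[F]_n) :
  v \in hirz_code pts e a b <->
  exists2 f, L_space e a b f & v = eval_vector pts f.
Proof.
rewrite /hirz_code /image_mem; set l := enum _.
split=> [|[f [s [k [/allP hs ->]]] ->]]; last first.
  rewrite eval_vector_sum big_seq; apply: memv_suml => m /hs Lm.
  apply/memvZ/memv_span/mapP; exists (BMultinom (L_monomial_mdeg Lm)) => //.
  by rewrite mem_enum inE.
have : all (L_monomial e a b) [seq bmnm m | m <- l].
  by apply/allP => _ /mapP[m + ->]; rewrite mem_enum.
rewrite (map_comp (fun m => eval_vector pts 'X_[m]) (@bmnm _ _)).
elim: [seq bmnm m | m <- l] v => {l} [|m l IHl] v.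
  move=> _; rewrite span_nil memv0 => /eqP->.
  exists 0; first by exists [::], (fun=> 0); rewrite big_nil.
  by apply/rowP => i; rewrite !mxE meval0.
rewrite [all _ _]/= => /andP[Lm Ll].
rewrite span_cons => /memv_addP[_ /vlineP[c ->] [w /(IHl _ Ll)]].
move=> [f Lf ->] ->; exists (c *: 'X_[m] + f).
  apply/L_spaceP => m' /msuppD_le; rewrite mem_cat => /orP[/msuppZ_le|].
    by rewrite msuppX inE => /eqP->.
  by move: m'; apply/L_spaceP.
by apply/rowP => i; rewrite !mxE mevalD mevalZ.
Qed.

Lemma card_P1_points (F : finFieldType) : #|P1_points F| = #|F|.+1.
Proof.
rewrite cardsU1 card_imset; last by move=> x y [].
rewrite (_ : _ \notin _ = true) ?add1n //.
by apply/imsetP => -[x _ [/eqP]]; rewrite eq_sym oner_eq0.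
Qed.

Lemma point_ordering_exists (F : finFieldType) :
  exists pts : (#|F|.+1 ^ 2)%N.-tuple ((F * F) * (F * F)), point_ordering pts.
Proof.
have h : size (enum (setX (P1_points F) (P1_points F))) == (#|F|.+1 ^ 2)%N.
  by rewrite -cardE cardsX card_P1_points.
by exists (Tuple h); split=> [|x]; rewrite ?enum_uniq ?mem_enum.
Qed.

(* Main.v *)
Require Import Defs.
From mathcomp Require Import all_boot all_order all_algebra.
From mathcomp Require Import mpoly.
From mathcomp Require Import finfield zify ring.

(** The weights depend only on the P^1-coordinate (x1, x2) of a point: once
    (t1, t2) is fixed, a product of monomials of C_e(a, b) and C_e(a', b') is
    a constant times a monomial of degree A = a + a' in x1, x2, so it is enough
    to find a nowhere-zero weight u on P^1(F_q) orthogonal to all forms of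
    degree A.  For A = q - 1 the weight 1 works.  For A <= q - 3, take for u
    the values of a form of degree k = q - 1 - A >= 2 without rational zero,
    namely x2^k - x1 x2^(k-1) - c x1^k, where c is not a value of the
    non-injective map z |-> z^k - z^(k-1).  Both cases then reduce to the fact
    that every form of degree q - 1 sums to zero over P^1(F_q).  For A = q - 2
    a linear form would be needed, and it always has a zero. *)

Import GRing.Theory.
Local Open Scope ring_scope.

(** The shift by 1 permutes the field, yet adds [#|F|%:R] to the sum of all its elements. *)
Lemma card_finField_eq0 (F : finFieldType) : #|F|%:R = 0 :> F.
Proof.
have: \sum_(x : F) x = \sum_(x : F) (x + 1) by rewrite (reindex_inj (addIr 1)).
rewrite big_split /= sumr_const => /esym/eqP.
by rewrite addrC -subr_eq0 addrK => /eqP.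
Qed.

(** For positive j, the polynomial X^j - 1 has at most j < q - 1 roots, so some g != 0 has g^j != 1.
    Substituting g x for x multiplies the sum by g^j, so the sum is 0. For j = 0 the sum is q, as
    0^0 = 1. *)
Lemma sum_expf_lt (F : finFieldType) j :
  (j < #|F|.-1)%N -> \sum_(x : F) x ^+ j = 0.
Proof.
case: j => [_|j ltj].
  by under eq_bigr do rewrite expr0; rewrite sumr_const card_finField_eq0.
have [g g0 gj] : exists2 g : F, g != 0 & g ^+ j.+1 != 1.
  apply/exists_inP; apply: contraLR ltj => /exists_inPn h.
  rewrite -leqNgt.
  have -> : #|F|.-1 = size (enum (predC1 (0 : F))) by rewrite -cardE cardC1.
  apply: max_unity_roots => //; last exact: enum_uniq.
  apply/allP => x; rewrite mem_enum => /h.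
  by rewrite negbK unity_rootE.
rewrite -subr_eq0 in gj; apply: (mulfI gj).
rewrite mulr0 mulrBl mul1r {2}(reindex_inj (mulfI g0)) /= mulr_sumr.
by apply/eqP; rewrite subr_eq0; apply/eqP/eq_bigr => x _; rewrite exprMn.
Qed.

Lemma sum_expf_pred (F : finFieldType) : \sum_(x : F) x ^+ #|F|.-1 = -1.
Proof.
have q1 := finNzRing_gt1 F.
rewrite (bigD1 0) //= expr0n -subn1 subn_eq0 leqNgt q1 add0r.
rewrite (eq_bigr (fun=> 1)) => [|x x0].
  rewrite sumr_const cardC1 -subn1 natrB ?card_finField_eq0 ?sub0r //.
  exact: ltnW.
apply: (mulfI x0); rewrite mulr1 -exprS subn1 prednK ?expf_card //.
exact: ltnW.
Qed.

(** If every c were a value, z |-> z^k - z^(k-1) would be injective on the finite field; but it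
    vanishes at both 0 and 1, since k - 1 > 0. *)
Lemma exists_expf_sub_neq (F : finFieldType) k : (1 < k)%N ->
  exists c : F, forall x : F, x ^+ k - x ^+ k.-1 - c != 0.
Proof.
case: k => [|[|k]] // _; pose f (x : F) := x ^+ k.+2 - x ^+ k.+1.
have /existsP[c cP] : [exists c, c \notin codom f].
  apply: contraT => /existsPn fsurj.
  have /image_injP finj : #|image f F| == #|F|.
    by apply/eqP/eq_card => c; have := fsurj c; rewrite negbK.
  have /eqP : 0 = 1 :> F.
    by apply: (finj 0 1) => //; rewrite /f !expr1n !expr0n !subrr.
  by rewrite eq_sym oner_eq0.
exists c => x; apply: contraNneq cP => /subr0_eq <-.
exact: codom_f.
Qed.

Lemma sum_P1_points (F : finFieldType) (G : F * F -> F) :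
  \sum_(x in P1_points F) G x = G (0, 1) + \sum_(z : F) G (1, z).
Proof.
rewrite big_setU1 /=; first by rewrite big_imset //= => x y _ _ [].
by apply/imsetP => -[x _ [/eqP]]; rewrite eq_sym oner_eq0.
Qed.

Lemma exists_P1_weight (F : finFieldType) A :
    (A.+2 < #|F|)%N \/ A = #|F|.-1 ->
  exists u : F * F -> F, (forall x, x \in P1_points F -> u x != 0) /\
    forall d1 d2, (d1 + d2)%N = A ->
      \sum_(x in P1_points F) u x * (x.1 ^+ d1 * x.2 ^+ d2) = 0.
Proof.
have q1 := finNzRing_gt1 F; case=> [ltA|eqA].
- pose k := (#|F|.-1 - A)%N.
  have k1 : (1 < k)%N by rewrite /k; lia.
  have [c cP] := exists_expf_sub_neq F k k1.
  (* At (0, 1), the only point with x1 = 0, the form reduces to x2^k = 1; at the other points x1 =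
     1. *)
  exists (fun x => if x.1 == 0 then 1 else x.2 ^+ k - x.2 ^+ k.-1 - c).
  split=> [_ /setU1P[->|/imsetP[z _ ->]]|d1 d2 dA] /=.
  + by rewrite eqxx oner_eq0.
  + by rewrite oner_eq0.
  rewrite sum_P1_points /= eqxx oner_eq0 expr1n mulr1 mul1r.
  under eq_bigr do rewrite expr1n mul1r !mulrBl -!exprD.
  (* Since k + A = q - 1 and d2 <= A, the exponents d2 and k - 1 + d2 stay below q - 1. Only k + d2
     can reach it, exactly when d1 = 0; the resulting -1 then cancels the term 0^0 = 1 of the point
     (0, 1). *)
  rewrite !sumrB -mulr_sumr [X in c * X]sum_expf_lt; last by lia.
  rewrite [X in _ + (_ - X - _)]sum_expf_lt; last by rewrite /k; lia.
  rewrite mulr0 !subr0 expr0n.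
  case: eqP => [d10|/eqP d10].
    have -> : (k + d2)%N = #|F|.-1 by rewrite /k; lia.
    by rewrite sum_expf_pred subrr.
  by rewrite sum_expf_lt ?addr0 // /k; lia.
- exists (fun=> 1); split=> [x _|d1 d2 dA]; first exact: oner_neq0.
  rewrite sum_P1_points /= expr1n mulr1 mul1r expr0n.
  under eq_bigr do rewrite expr1n !mul1r.
  case: eqP => [d10|/eqP d10].
    by have -> : d2 = #|F|.-1 by [lia]; rewrite sum_expf_pred subrr.
  by rewrite sum_expf_lt ?addr0 //; lia.
Qed.

Lemma meval_point_val (F : finFieldType) (x t : F * F) (m : 'X_{1..4}) :
  ('X_[F, m]).@[point_val (x, t)] =
  x.1 ^+ m iX1 * x.2 ^+ m iX2 * (t.1 ^+ m iT1 * t.2 ^+ m iT2).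
Proof.
rewrite mevalX !big_ord_recr big_ord0 /= mul1r !mulrA.
by congr (_ ^+ m _ * _ ^+ m _ * _ ^+ m _ * _ ^+ m _); apply: val_inj.
Qed.

Lemma sum_weight_L_space (F : finFieldType) (u : F * F -> F) e a b a' b'
    (f g : {mpoly F[4]}) (t : F * F) :
    (forall d1 d2, (d1 + d2)%N = (a + a')%N ->
      \sum_(x in P1_points F) u x * (x.1 ^+ d1 * x.2 ^+ d2) = 0) ->
  L_space e a b f -> L_space e a' b' g ->
  \sum_(x in P1_points F)
    u x * f.@[point_val (x, t)] * g.@[point_val (x, t)] = 0.
Proof.
move=> u_orth [s [k [/allP Ls ->]]] [s' [k' [/allP Ls' ->]]].
under eq_bigr => x _ do rewrite -mulrA !raddf_sum mulr_suml mulr_sumr.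
rewrite exchange_big big_seq big1 //= => m /Ls/andP[/eqP ma _].
under eq_bigr => x _ do rewrite 2!mulr_sumr.
rewrite exchange_big big_seq big1 //= => m' /Ls'/andP[/eqP ma' _].
pose c := k m * k' m' * (t.1 ^+ m iT1 * t.2 ^+ m iT2) *
  (t.1 ^+ m' iT1 * t.2 ^+ m' iT2).
transitivity (c * \sum_(x in P1_points F)
    u x * (x.1 ^+ (m iX1 + m' iX1) * x.2 ^+ (m iX2 + m' iX2))).
  rewrite mulr_sumr; apply: eq_bigr => x _.
  by rewrite !mevalZ !meval_point_val !exprD /c; ring.
by rewrite u_orth ?mulr0 //; lia.
Qed.

Theorem corollary5p11 (q : nat) (F : finFieldType) (hq : #|F| = q)
    (pts : (q.+1 ^ 2)%N.-tuple ((F * F) * (F * F)))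
    (hpts : point_ordering pts)
    (e a b : nat) (ha : a%:Z <= q%:Z - 2) (hb : 0 <= b%:Z - e%:Z * a%:Z)
    (a' b' : nat) (ha' : (0 < a')%N) (hb' : (0 < b')%N)
    (haa' : a%:Z <= q%:Z - a'%:Z - 3 \/ a%:Z = q%:Z - a'%:Z - 1) :
  exists C : {vspace 'rV[F]_(q.+1 ^ 2)},
    code_equiv C (hirz_code pts e a b) /\
    {subset C <= dual_code (hirz_code pts e a' b')}.
Proof.
have hA : ((a + a').+2 < #|F|)%N \/ (a + a')%N = #|F|.-1 by rewrite hq; lia.
have [u [u0 u_orth]] := exists_P1_weight F (a + a')%N hA.
have [pts_uniq ptsE] := hpts.
pose y : 'rV[F]_(q.+1 ^ 2) := \row_i u (tnth pts i).1.
have y0 i : y 0 i != 0.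
  rewrite mxE u0 //; have := mem_tnth i pts; rewrite ptsE.
  by case: (tnth pts i) => x t; rewrite in_setX => /andP[].
pose h : 'End('rV[F]_(q.+1 ^ 2)) := linfun (mulmxr (diag_mx y)).
have hE v i : h v 0 i = y 0 i * v 0 i.
  by rewrite lfunE /= mul_mx_diag mxE mulrC.
exists (h @: hirz_code pts e a b)%VS; split.
  (* [code_equiv] rescales its first code into its second: going from the image of [h] back to
     [hirz_code pts e a b] takes the inverse weights. *)
  exists (\row_i (y 0 i)^-1); split=> [i|v]; first by rewrite mxE invr_eq0.
  split=> [vC|[_ /memv_imgP[w wC ->] ->]].
    exists (h v); first exact: memv_img.
    by apply/rowP => i; rewrite 2!mxE hE mulKf.
  rewrite (_ : \row_i _ = w) //.
  by apply/rowP => i; rewrite 2!mxE hE mulKf.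
move=> _ /memv_imgP[w /hirz_codeP[f Lf ->] ->].
rewrite inE; apply/forall_inP => c /hirz_codeP[g Lg ->]; apply/eqP.
pose G p := u p.1 * f.@[point_val p] * g.@[point_val p].
transitivity (\sum_(i < q.+1 ^ 2) G (tnth pts i)).
  by apply: eq_bigr => i _; rewrite hE !mxE.
(* As [pts] lists each pair of points exactly once, the sum over coordinates is a double sum over
   P^1 x P^1, whose sum over x vanishes for each fixed t. *)
rewrite -(big_tuple 0 +%R pts xpredT G) big_uniq //= (eq_bigl _ _ ptsE).
transitivity (\sum_(x in P1_points F) \sum_(t in P1_points F) G (x, t)).
  rewrite pair_big; apply: eq_big => [[x t]|[x t] _] //=.
  by rewrite in_setX.
rewrite exchange_big big1 //= => t _.
exact: (sum_weight_L_space _ _ _ _ _ _ _ _ _ _ u_orth Lf Lg).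
Qed.
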